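(* Let $d_1,d_2,d_3$ be positive integers with $\gcd(d_1,d_2,d_3)=1$ and $4\le d_1<d_2<d_3\le d_1d_2-d_1-d_2$, such that none of them is a linear combination of the other two with non-negative integer coefficients, and suppose that the numerical semigroup $S_3=\langle d_1,d_2,d_3\rangle$ is non-symmetric. Let $G_0$ be its genus, $c_3$ its conductor and $w_3=G_0/c_3$. Then Wilf's question has an affirmative answer for $S_3$, i.e. $$w_3\le \frac{2}{3},$$ with equality only if $(d_1,d_2,d_3)=(3,4,5)$ (so that, since $d_1\ge 4$, the inequality is strict).
   Context: $S_3=\langle d_1,d_2,d_3\rangle$ is the set of all linear combinations of $d_1,d_2,d_3$ with non-negative integer coefficients (so $0\in S_3$). The set of gaps is $\Delta_3=\mathbb{Z}_{>0}\setminus S_3$, the genus is $G_0=\#\Delta_3$, the Frobenius number $F_3$ is the largest element of $\Delta_3$, and the conductor is $c_3=F_3+1$. The semigroup is symmetric if for every gap $s\in\Delta_3$ one has $F_3-s\notin\Delta_3$, and non-symmetric otherwise. Wilf's question for a numerical semigroup $S_m$ minimally generated by $m$ integers, with genus $G_0$ and conductor $c_m$, asks whether $G_0/c_m\le (m-1)/m$, with equality only for the generators $m,m+1,\ldots,2m-1$. *)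

(* Defs.v *)
From mathcomp Require Import all_boot all_order all_algebra finmap.
From mathcomp Require Import all_classical.

Set Implicit Arguments.
Unset Strict Implicit.
Unset Printing Implicit Defensive.

Import Order.TTheory GRing.Theory Num.Theory.

Local Open Scope classical_set_scope.

Definition semigroup_span (d : seq nat) : set nat :=
  [set s | exists a : nat -> nat, s = \sum_(i < size d) a i * nth 0 d i].

Definition gaps (d : seq nat) : set nat :=
  [set s | 0 < s /\ ~ semigroup_span d s].

(* [fset_set A] enumerates [A] when [A] is finite and is empty otherwise, so
   [genus] and [frobenius] have their usual meaning when the generators have
   gcd 1 (and, for [frobenius], none of them is 1). *)
Definition genus (d : seq nat) : nat := #|` fset_set (gaps d)|%fset.

Definition frobenius (d : seq nat) : nat := \max_(s <- fset_set (gaps d)) s.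

Definition conductor (d : seq nat) : nat := (frobenius d).+1.

(* Not truncated when there are finitely many gaps: then [s <= frobenius d]. *)
Definition symmetric_semigroup (d : seq nat) : Prop :=
  forall s, gaps d s -> ~ gaps d (frobenius d - s).

Definition wilf_ratio (d : seq nat) : rat :=
  ((genus d)%:R / (conductor d)%:R)%R.

(* Main.v *)
Require Import Defs.
From mathcomp Require Import all_boot all_order all_algebra.
From mathcomp Require Import finmap all_classical zify.

Set Implicit Arguments.
Unset Strict Implicit.
Unset Printing Implicit Defensive.

Import Order.TTheory GRing.Theory Num.Theory.

(** Let S be the semigroup, F its Frobenius number and c = F + 1.  A gap f is
    pseudo-Frobenius when f + d1, f + d2, f + d3 all lie in S.  Climbing from a
    gap x by adding generators as long as one stays outside S, one reaches a
    pseudo-Frobenius number f with f - x in S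
    ([gap_below_pseudo_frobenius]).

    A semigroup with three generators has at most two pseudo-Frobenius numbers
    ([pseudo_frobenius_at_most_two]).  One of them is F; as S is not symmetric,
    there is exactly one other, f < F.  Hence every gap is of the form F - s or
    f - s with s in S.  There are n = c - g elements of S below c, so
    g <= 2 n, that is 3 g <= 2 c ([two_reflections_bound]).

    The inequality is strict unless S has no element in ]f, F] and no x has
    both F - x and f - x in S.  The second condition prevents F + d1 and f + d1
    from sharing a generator among d2 and d3, so one is a d2 and the other is
    b d3.  From this, d2 + d3 = u d1 and (a + 1) d2 = y d1 + b d3 with y > 0
    ([pure_expansion_relation]), so F - f is the difference, in one order or
    the other, of y d1 and d2, both in S.  These give a forbidden x when they
    are small enough, which can only fail when a = b = 1; but then d1 divides
    3 d2 and 3 d3, hence divides 3, against d1 >= 4 ([strictness_witness]). *)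

(** * Three-generated semigroups and their pseudo-Frobenius numbers *)

Definition span3 (d1 d2 d3 x : nat) : Prop :=
  exists a b c, x = a * d1 + b * d2 + c * d3.

Definition pseudo_frobenius (d1 d2 d3 f : nat) : Prop :=
  [/\ ~ span3 d1 d2 d3 f, span3 d1 d2 d3 (f + d1),
      span3 d1 d2 d3 (f + d2) & span3 d1 d2 d3 (f + d3)].

Lemma span3_rot d1 d2 d3 x : span3 d1 d2 d3 x -> span3 d2 d3 d1 x.
Proof. by move=> [a [b [c ->]]]; exists b, c, a; lia. Qed.

Lemma pseudo_frobenius_rot d1 d2 d3 f :
  pseudo_frobenius d1 d2 d3 f -> pseudo_frobenius d2 d3 d1 f.
Proof.
move=> [Nf f1 f2 f3]; split; try exact: span3_rot.
by move=> Sf; apply: Nf; do 2!apply: span3_rot.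
Qed.

(** An expansion of [f + d1] that used [d1] would put [f] itself in the
    semigroup. *)
Lemma pseudo_frobenius_add d1 d2 d3 f :
  pseudo_frobenius d1 d2 d3 f -> exists b c, f + d1 = b * d2 + c * d3.
Proof.
move=> [Nf [[|a] [b [c E]]] _ _]; first by exists b, c; lia.
by case: Nf; exists a, b, c; lia.
Qed.

(** Adding a nonzero element of the semigroup to a pseudo-Frobenius number lands
    in the semigroup, so such an addition cannot produce another gap. *)
Lemma pseudo_frobenius_incomparable d1 d2 d3 f g b c :
  pseudo_frobenius d1 d2 d3 f -> pseudo_frobenius d1 d2 d3 g ->
  g = f + (b * d2 + c * d3) -> g = f.
Proof.
move=> [Nf _ [p [q [r E2]]] [s [t [u E3]]]] [Ng _ _ _].
case: b => [|b].
  case: c => [|c] E; first by lia.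
  by case: Ng; exists s, t, (u + c); lia.
by move=> E; case: Ng; exists p, (q + b), (r + c); lia.
Qed.

(** Expansions need not be unique, since [d2] and [d3] may satisfy a relation not
    involving [d1]; the one with the most copies of [d2] is a normal form. *)
Lemma max_expansion d1 d2 d3 f : 0 < d2 ->
  pseudo_frobenius d1 d2 d3 f ->
  exists x y, f + d1 = x * d2 + y * d3 /\
    forall x' y', f + d1 = x' * d2 + y' * d3 -> x' <= x.
Proof.
move=> d2_gt0 /pseudo_frobenius_add[b [c E]].
pose P x := `[< exists y, f + d1 = x * d2 + y * d3 >].
have exP : exists x, P x by exists b; apply/asboolP; exists c.
have leP x : P x -> x <= f + d1 by move=> /asboolP[y]; nia.
case: (ex_maxnP exP leP) => x /asboolP[y Exy] maxx.
by exists x, y; split=> // x' y' E'; apply: maxx; apply/asboolP; exists y'.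
Qed.

(* These two lemmas turn inequalities into substitutions, so that every identity
   below becomes linear over the monomials, without truncated subtraction. *)
Lemma ltn_witness m n : m < n -> exists k, n = m + k.+1.
Proof. by move=> lt_mn; exists (n - m).-1; lia. Qed.

Lemma leq_witness m n : m <= n -> exists k, n = m + k.
Proof. by move=> le_mn; exists (n - m); lia. Qed.

(** * There are at most two pseudo-Frobenius numbers *)

(** The points (x, y) with f + d1 = x d2 + y d3, f pseudo-Frobenius, form an
    antichain.  If g lies strictly between f and h in it, then the expansions of
    g + d2 and g + d3 yield two relations expressing positive combinations of d2
    and d3, with coefficients bounded by (xg + 1, yg) and (xg, yg + 1), as
    multiples of d1: larger coefficients would put h or f in the semigroup.
    The difference of these relations rewrites part of the expansion of g + d1,
    which either brings in d1, so that g is not a gap, or trades d3 for d2,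
    against the maximality of xg. *)
Lemma no_middle_pseudo_frobenius d1 d2 d3 f g h xf yf xg yg xh yh :
  0 < d2 ->
  pseudo_frobenius d1 d2 d3 f -> pseudo_frobenius d1 d2 d3 g ->
  pseudo_frobenius d1 d2 d3 h ->
  f + d1 = xf * d2 + yf * d3 ->
  g + d1 = xg * d2 + yg * d3 ->
  (forall x y, g + d1 = x * d2 + y * d3 -> x <= xg) ->
  h + d1 = xh * d2 + yh * d3 ->
  xf < xg -> xg < xh -> False.
Proof.
move=> d2_gt0 Pf Pg Ph Ef Eg maxg Eh ltfg ltgh.
have [Nf _ _ _] := Pf; have [Ng _ _ _] := Pg; have [Nh _ _ _] := Ph.
have [i Ei] := ltn_witness ltfg; have [j Ej] := ltn_witness ltgh.
have /ltn_witness[k Ek] : yg < yf.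
  rewrite ltnNge; apply/negP => /leq_witness[k Ek].
  have E : g = f + (i.+1 * d2 + k * d3) by subst; lia.
  by have := pseudo_frobenius_incomparable Pf Pg E; nia.
have /pseudo_frobenius_rot/pseudo_frobenius_add[c2 [a2 E2]] := Pg.
have /pseudo_frobenius_rot/pseudo_frobenius_rot/pseudo_frobenius_add[a3 [b3 E3]]
  := Pg.
have /ltn_witness[p Ep] : c2 < yg.
  rewrite ltnNge; apply/negP => /leq_witness[l El].
  by apply: Nh; exists a2, j, (l + yh); subst; lia.
have /ltn_witness[q Eq] : b3 < xg.
  rewrite ltnNge; apply/negP => /leq_witness[l El].
  by apply: Nf; exists a3, (xf + l), k; subst; lia.
have R2 : xg.+1 * d2 + p.+1 * d3 = a2.+1 * d1 by subst; lia.
have R3 : q.+1 * d2 + yg.+1 * d3 = a3.+1 * d1 by subst; lia.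
(* The difference of R2 and R3, with its terms put where they are positive. *)
have R : b3.+1 * d2 + a3 * d1 = c2.+1 * d3 + a2 * d1 by subst; lia.
case: (ltngtP a2 a3) => [/ltn_witness[u Eu]|/ltn_witness[u Eu]|Ea].
- by apply: Ng; exists u, (xg + b3.+1), p; subst; lia.
- by apply: Ng; exists u, q, (yg + c2.+1); subst; lia.
have /maxg : g + d1 = (xg + b3.+1) * d2 + p * d3 by subst; lia.
lia.
Qed.

(** Normal-form expansions of distinct pseudo-Frobenius numbers have distinct
    first coordinates, so of three of them one would be in the middle. *)
Lemma pseudo_frobenius_at_most_two d1 d2 d3 f g h :
  0 < d2 ->
  pseudo_frobenius d1 d2 d3 f -> pseudo_frobenius d1 d2 d3 g ->
  pseudo_frobenius d1 d2 d3 h -> [\/ f = g, g = h | f = h].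
Proof.
move=> d2_gt0 Pf Pg Ph.
have [xf [yf [Ef maxf]]] := max_expansion d2_gt0 Pf.
have [xg [yg [Eg maxg]]] := max_expansion d2_gt0 Pg.
have [xh [yh [Eh maxh]]] := max_expansion d2_gt0 Ph.
have same f1 f2 x y1 y2 : pseudo_frobenius d1 d2 d3 f1 ->
    pseudo_frobenius d1 d2 d3 f2 -> f1 + d1 = x * d2 + y1 * d3 ->
    f2 + d1 = x * d2 + y2 * d3 -> f1 = f2.
  move=> P1 P2 E1 E2.
  case: (leqP y1 y2) => [|/ltnW] /leq_witness[k Ek].
    by rewrite (@pseudo_frobenius_incomparable d1 d2 d3 f1 f2 0 k) //; nia.
  by rewrite (@pseudo_frobenius_incomparable d1 d2 d3 f2 f1 0 k) //; nia.
have no f1 g1 h1 x1 y1 x2 y2 x3 y3 :=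
  @no_middle_pseudo_frobenius d1 d2 d3 f1 g1 h1 x1 y1 x2 y2 x3 y3 d2_gt0.
case: (ltngtP xf xg) => [fg|gf|efg]; last first.
- by apply: Or31; rewrite efg in Ef; apply: same Ef Eg.
- case: (ltngtP xf xh) => [fh|hf|efh].
  + by case: (no g f h xg yg xf yf xh yh).
  + case: (ltngtP xg xh) => [gh|hg|egh].
    * by case: (no g h f xg yg xh yh xf yf).
    * by case: (no h g f xh yh xg yg xf yf).
    * by apply: Or32; rewrite egh in Eg; apply: same Eg Eh.
  + by apply: Or33; rewrite efh in Ef; apply: same Ef Eh.
- case: (ltngtP xf xh) => [fh|hf|efh].
  + case: (ltngtP xg xh) => [gh|hg|egh].
    * by case: (no f g h xf yf xg yg xh yh).
    * by case: (no f h g xf yf xh yh xg yg).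
    * by apply: Or32; rewrite egh in Eg; apply: same Eg Eh.
  + by case: (no h f g xh yh xf yf xg yg).
  + by apply: Or33; rewrite efh in Ef; apply: same Ef Eh.
Qed.

(** * Strictness *)

(** Expanding g + d2 and f + d3, with d2 and d3 minimal generators, gives
    d2 + (p + 1) d3 = u d1 and (q + 1) d2 + d3 = v d1.  Comparing them forces
    u = v, then p = 0 by purity.  With d2 + d3 = u d1 at hand, the expansion
    (a + 1) d2 = y d1 + y3 d3 obtained from f + d2 can only have y3 = b: any
    other value puts f or g in the semigroup, contradicts purity, or makes d2
    redundant. *)
Lemma pure_expansion_relation d1 d2 d3 f g a b :
  pseudo_frobenius d1 d2 d3 f -> pseudo_frobenius d1 d2 d3 g ->
  ~ (exists x y, d2 = x * d1 + y * d3) ->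
  ~ (exists x y, d3 = x * d1 + y * d2) ->
  f + d1 = a * d2 -> g + d1 = b * d3 ->
  (forall x y, f + d1 <> x * d2 + y.+1 * d3) ->
  exists u y, [/\ d2 + d3 = u * d1 & a.+1 * d2 = y.+1 * d1 + b * d3].
Proof.
move=> Pf Pg min2 min3 Ef Eg pure.
have [Nf _ _ _] := Pf; have [Ng _ _ _] := Pg.
have /pseudo_frobenius_rot/pseudo_frobenius_add[b1 [u1 E1]] := Pg.
have /pseudo_frobenius_rot/pseudo_frobenius_rot/pseudo_frobenius_add[v2 [a2 E2]]
  := Pf.
have /ltn_witness[p Ep] : b1 < b.
  rewrite ltnNge; apply/negP => /leq_witness[l El].
  by apply: min2; exists u1.+1, l; subst; lia.
have /ltn_witness[q Eq] : a2 < a.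
  rewrite ltnNge; apply/negP => /leq_witness[l El].
  by apply: min3; exists v2.+1, l; subst; lia.
have R1 : d2 + p.+1 * d3 = u1.+1 * d1 by subst; lia.
have R2 : q.+1 * d2 + d3 = v2.+1 * d1 by subst; lia.
have Euv : u1 = v2.
  case: (ltngtP u1 v2) => // /ltn_witness[k Ek].
  - by case: Nf; exists k, a2.+1, p; subst; lia.
  - by case: Ng; exists k, q, b1.+1; subst; lia.
have {}Ep : p = 0.
  case: p {Ep} R1 => // p R1; case: (pure a2.+1 p); subst; lia.
have R : d2 + d3 = u1.+1 * d1 by subst; lia.
have /pseudo_frobenius_rot/pseudo_frobenius_add[y3 [y1 E3]] := Pf.
have /pseudo_frobenius_rot/pseudo_frobenius_rot/pseudo_frobenius_add[z1 [t2 E4]]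
  := Pg.
exists u1.+1, y1; split=> //.
case: (ltngtP y3 b) => [/ltn_witness[k Ek]|/ltn_witness[k Ek]|Ey].
- case: (ltngtP u1 y1) => [/ltn_witness[l El]|/ltn_witness[l El]|El].
  + by case: Nf; exists l, 0, y3.+1; subst; lia.
  + by case: Ng; exists l, a, k; subst; lia.
  + by case: (pure 0 y3); subst; lia.
- case: t2 E4 => [|t2] E4.
    case: (leqP z1 u1) => [/leq_witness[l El]|/ltn_witness[l El]].
    + by case: min2; exists l, b; subst; nia.
    + by case: Ng; exists l, 1, 0; subst; lia.
  by case: Nf; exists (y1 + z1.+1), t2, k; subst; lia.
- by subst; lia.
Qed.

Lemma dvd_three_of_relations d1 d2 d3 u y :
  gcdn (gcdn d1 d2) d3 = 1 ->
  d2 + d3 = u * d1 -> 2 * d2 = y * d1 + d3 -> d1 %| 3.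
Proof.
move=> hgcd Eu Ey.
have cop : coprime d1 (gcdn d2 d3) by rewrite /coprime gcdnA hgcd.
rewrite -(Gauss_dvdl 3 cop) muln_gcdr dvdn_gcd; apply/andP; split.
  by apply/dvdnP; exists (u + y); lia.
have D3 : d1 %| 3 * d2 by apply/dvdnP; exists (u + y); lia.
rewrite -(dvdn_addr _ D3); apply/dvdnP; exists (3 * u); lia.
Qed.

(** Without a witness, F + d1 and f + d1 are multiples of d2 and d3, in one order
    or the other, and the relations above write F - f as y d1 - d2 or as
    d2 - y d1; the missing witness is then x = f - d2 or x = F - d2. *)
Lemma strictness_witness d1 d2 d3 F f :
  gcdn (gcdn d1 d2) d3 = 1 -> 4 <= d1 -> d1 < d2 -> d2 < d3 ->
  ~ (exists x y, d2 = x * d1 + y * d3) ->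
  ~ (exists x y, d3 = x * d1 + y * d2) ->
  pseudo_frobenius d1 d2 d3 F -> pseudo_frobenius d1 d2 d3 f -> f < F ->
  (exists2 y, f < y <= F & span3 d1 d2 d3 y) \/
  (exists2 x, x <= f & span3 d1 d2 d3 (F - x) /\ span3 d1 d2 d3 (f - x)).
Proof.
move=> hgcd d1_ge4 lt12 lt23 min2 min3 PF Pf ltfF.
apply: contrapT => /not_orP[noelt nocommon].
(* If both expansions use d2, then x = d2 - d1 is a common reflection. *)
have share2 a b a' b' : F + d1 = a.+1 * d2 + b * d3 ->
    f + d1 = a'.+1 * d2 + b' * d3 -> False.
  move=> EF Ef; apply: nocommon; exists (d2 - d1); first by nia.
  by split; [exists 0, a, b | exists 0, a', b']; nia.
have share3 a b a' b' : F + d1 = a * d2 + b.+1 * d3 ->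
    f + d1 = a' * d2 + b'.+1 * d3 -> False.
  move=> EF Ef; apply: nocommon; exists (d3 - d1); first by nia.
  by split; [exists 0, a, b | exists 0, a', b']; nia.
have [a [b EF]] := pseudo_frobenius_add PF.
have [a' [b' Ef]] := pseudo_frobenius_add Pf.
case: a EF => [|a] EF.
  case: b EF => [|b] EF; first by lia.
  case: b' Ef => [|b'] Ef; last by case: (share3 _ _ _ _ EF Ef).
  case: a' Ef => [|a'] Ef; first by lia.
  have [] := @pure_expansion_relation d1 d2 d3 f F a'.+1 b.+1 => //.
  - by lia.
  - by move=> x y E; apply: share3 EF E.
  move=> u [y [Eu Ey]].
  case: (leqP d2 F) => [le2F|lt2F].
    apply: nocommon; exists (F - d2); first by nia.
    by split; [exists 0, 1, 0 | exists y.+1, 0, 0]; nia.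
  (* Here F < d2, which leaves only F + d1 = d3 and f + d1 = d2. *)
  have Eb : b = 0 by nia.
  have Ea : a' = 0 by nia.
  have /(dvdn_leq (isT : 0 < 3)) : d1 %| 3.
    by apply: (@dvd_three_of_relations d1 d2 d3 u y.+1); rewrite // Ea Eb in Ey *;
       lia.
  by lia.
case: a' Ef => [|a'] Ef; last by case: (share2 _ _ _ _ EF Ef).
case: b' Ef => [|b'] Ef; first by lia.
case: b EF => [|b] EF; last by case: (share3 _ _ _ _ EF Ef).
have [] := @pure_expansion_relation d1 d2 d3 F f a.+1 b'.+1 => //.
- by lia.
- by move=> x y E; apply: share3 E Ef.
move=> u [y [Eu Ey]].
have le2F : d2 <= F.
  have a_gt0 : 0 < a by rewrite lt0n; apply: contraTneq lt23 => a0; nia.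
  by case: a a_gt0 EF {Ey} => [|a] _ EF; nia.
have le2f : d2 <= f.
  rewrite leqNgt; apply/negP => ltf2; apply: noelt; exists d2; first by lia.
  by exists 0, 1, 0; lia.
apply: nocommon; exists (f - d2); first by lia.
by split; [exists y.+1, 0, 0 | exists 0, 1, 0]; lia.
Qed.

(** * Gaps, genus and conductor *)

(** By Bezout the semigroup contains two consecutive integers q and q + 1.
    Every x >= q^2 is a combination of them: if x = t q + r with r < q <= t,
    then x = (t - r) q + r (q + 1). *)
Lemma span3_cofinite d1 d2 d3 : 0 < d2 -> 0 < d3 ->
  gcdn (gcdn d1 d2) d3 = 1 ->
  exists N, forall x, N <= x -> span3 d1 d2 d3 x.
Proof.
move=> pos2 pos3 hgcd.
have [k2 k1 Ek _] := egcdnP d1 pos2.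
have [k3 k Ek3 _] := egcdnP (gcdn d1 d2) pos3.
rewrite [gcdn d2 d1]gcdnC in Ek; rewrite [gcdn d3 _]gcdnC hgcd in Ek3.
pose q := k * k2 * d2.
have Eq1 : q + 1 = k3 * d3 + k * k1 * d1 by rewrite /q; nia.
exists (q * q) => x le_x.
case: (posnP q) => [q0|q_gt0].
  by exists (x * (k * k1)), 0, (x * k3); nia.
have Ex := divn_eq x q.
have ltr := ltn_pmod x q_gt0.
have let_ : q <= x %/ q by rewrite leq_divRL.
have /leq_witness[l El] : x %% q <= x %/ q by lia.
exists (x %% q * (k * k1)), (l * (k * k2)), (x %% q * k3).
rewrite [in LHS]Ex El mulnDl; move: (x %% q) Eq1 => r; rewrite /q; nia.
Qed.

(** Induction on [F - x]: either [x] is pseudo-Frobenius, or adding some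
    generator to [x] gives a larger gap. *)
Lemma gap_below_pseudo_frobenius d1 d2 d3 F : 0 < d1 -> 0 < d2 -> 0 < d3 ->
  (forall x, ~ span3 d1 d2 d3 x -> x <= F) ->
  forall x, ~ span3 d1 d2 d3 x ->
  exists f, [/\ pseudo_frobenius d1 d2 d3 f, x <= f & span3 d1 d2 d3 (f - x)].
Proof.
move=> pos1 pos2 pos3 maxF x; have [n] := ubnP (F - x).
elim: n x => // n IHn x ltn Nx.
have lexF := maxF x Nx.
have step d : 0 < d -> (forall y, span3 d1 d2 d3 y -> span3 d1 d2 d3 (y + d)) ->
    ~ span3 d1 d2 d3 (x + d) ->
    exists f, [/\ pseudo_frobenius d1 d2 d3 f, x <= f
      & span3 d1 d2 d3 (f - x)].
  move=> d_gt0 addd Nxd; have ltxF := maxF _ Nxd.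
  have [|f [Pf lef Sf]] := IHn (x + d) _ Nxd; first by lia.
  exists f; split=> //; first by lia.
  by have -> : f - x = f - (x + d) + d by [lia]; apply: addd.
case: (pselect (span3 d1 d2 d3 (x + d1))) => [S1|]; last first.
  apply: step => // y [a [b [c ->]]]; exists a.+1, b, c; lia.
case: (pselect (span3 d1 d2 d3 (x + d2))) => [S2|]; last first.
  apply: step => // y [a [b [c ->]]]; exists a, b.+1, c; lia.
case: (pselect (span3 d1 d2 d3 (x + d3))) => [S3|]; last first.
  apply: step => // y [a [b [c ->]]]; exists a, b, c.+1; lia.
by exists x; split=> //; exists 0, 0, 0; lia.
Qed.

(** Each non-member of [s] is a reflection of a member through [F] or [f], so
    there are at most twice as many non-members as members.  A member between
    [f] and [F] has no reflection through [f], and a point [x] reached by both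
    reflections is counted twice, so either makes the bound strict. *)
Lemma two_reflections_bound (s : pred nat) F f : f < F ->
  (forall x, x <= F -> ~~ s x -> s (F - x) || (x <= f) && s (f - x)) ->
  (exists2 y, f < y <= F & s y) \/
    (exists2 x, x <= f & s (F - x) && s (f - x)) ->
  3 * (\sum_(x < F.+1) ~~ s x) < 2 * F.+1.
Proof.
move=> ltfF cover strict.
pose S := \sum_(x < F.+1) s x.
have ES : S + \sum_(x < F.+1) ~~ s x = F.+1.
  rewrite -big_split /= -[RHS]mul1n -[in RHS](card_ord F.+1) mulnC -sum_nat_const.
  by apply: eq_bigr => x _; case: (s x).
have Erev : \sum_(x < F.+1) s (F - x) = S.
  rewrite /S (reindex_inj rev_ord_inj) /=; apply: eq_bigr => x _.
  by congr (nat_of_bool (s _)); rewrite /=; have := ltn_ord x; lia.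
(* The truncated subtraction f - x is only read where x <= f. *)
have Erevf : \sum_(x < F.+1) ((x <= f) && s (f - x) : nat) +
    \sum_(x < F.+1) ((f < x) && s x : nat) = S.
  have -> : \sum_(x < F.+1) ((x <= f) && s (f - x) : nat) =
      \sum_(x < F.+1) ((x <= f) && s x : nat).
    have trunc (t : pred nat) : \sum_(x < F.+1) ((x <= f) && t x : nat) =
        \sum_(x < f.+1) t x.
      rewrite (big_ord_widen_cond F.+1 xpredT (fun x => t x : nat)) /=; last by lia.
      rewrite [RHS]big_mkcond /=; apply: eq_bigr => x _.
      by rewrite ltnS; case: (x <= f).
    rewrite (trunc (fun x => s (f - x))) trunc.
    rewrite (reindex_inj rev_ord_inj) /=; apply: eq_bigr => x _.
    by congr (nat_of_bool (s _)); rewrite /=; have := ltn_ord x; lia.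
  rewrite -big_split /=; apply: eq_bigr => x _.
  by rewrite ltnNge; case: (x <= f); case: (s x).
suff : \sum_(x < F.+1) ~~ s x < S + S by lia.
rewrite -{1}Erev -Erevf addnA -big_split /=.
have lepw (x : 'I_F.+1) : ~~ s x <= s (F - x) + ((x <= f) && s (f - x)).
  have /implyP := cover x (leq_ord x); case: (s x) => //=.
  by case: (s (F - x)); case: (_ && _).
case: strict => [[y /andP[lty leyF] sy]|[x lex /andP[s1 s2]]].
  rewrite -addn1 leq_add ?leq_sum //.
  rewrite (bigD1 (Ordinal (leyF : y < F.+1))) //= lty sy; lia.
have ltxF : x < F.+1 by lia.
rewrite -[X in X < _]addn0 -addSn leq_add //.
rewrite (bigD1 (Ordinal ltxF)) //= [X in _ < X](bigD1 (Ordinal ltxF)) //=.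
rewrite s1 s2 lex -addSn leq_add ?leq_sum //; by case: (s x).
Qed.

Lemma bigmax_mem (s : seq nat) : s != [::] -> \max_(x <- s) x \in s.
Proof.
elim: s => // x [|y s] IHs _; first by rewrite big_seq1 mem_head.
rewrite big_cons inE; case: (leqP (\max_(z <- y :: s) z) x) => _.
  by rewrite eqxx.
by rewrite IHs ?orbT.
Qed.

Lemma finite_gaps d N : (forall x, gaps d x -> x <= N) -> finite_set (gaps d).
Proof. by move=> ub; apply: (sub_finite_set _ (finite_II N.+1)) => x /ub. Qed.

Lemma frobenius_gap d N x :
  (forall y, gaps d y -> y <= N) -> gaps d x -> gaps d (frobenius d).
Proof.
move=> ub gx; have fin := finite_gaps ub.
apply/set_mem; rewrite -(in_fset_set fin); apply: bigmax_mem.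
have : x \in fset_set (gaps d) by rewrite in_fset_set // mem_set.
move=> xin; apply/eqP => s0.
by move: (xin : x \in enum_fset (fset_set (gaps d))); rewrite s0.
Qed.

Lemma leq_frobenius d N x :
  (forall y, gaps d y -> y <= N) -> gaps d x -> x <= frobenius d.
Proof.
move=> ub gx; apply: (@leq_bigmax_seq _ _ xpredT id) => //.
by rewrite in_fset_set ?mem_set //; apply: finite_gaps ub.
Qed.

Lemma genus_sum d N : (forall x, gaps d x -> x <= N) ->
  genus d = \sum_(x < N.+1) `[< gaps d x >].
Proof.
move=> ub; rewrite -(big_mkord xpredT (fun x => `[< gaps d x >] : nat)).
have -> : \sum_(0 <= x < N.+1) (`[< gaps d x >] : nat) =
    count (fun x => `[< gaps d x >]) (iota 0 N.+1).
  by rewrite -sum1_count [RHS]big_mkcond /index_iota subn0; apply: eq_bigr => x _;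
     case: asboolP.
rewrite -size_filter; apply: perm_size; apply: uniq_perm.
- exact: fset_uniq.
- by rewrite filter_uniq ?iota_uniq.
move=> x; rewrite mem_filter mem_iota /= add0n ltnS.
have -> : (x \in enum_fset (fset_set (gaps d))) = `[< gaps d x >].
  have /= -> := in_fset_set (finite_gaps ub) x.
  by apply/idP/asboolP => [/set_mem|/mem_set].
by case: asboolP => // /ub ->.
Qed.

Lemma semigroup_span2 d1 d2 x :
  semigroup_span [:: d1; d2] x <-> exists a b, x = a * d1 + b * d2.
Proof.
split=> [[a ->]|[a [b ->]]].
  by exists (a 0), (a 1); rewrite !big_ord_recl big_ord0 /= addn0.
by exists (nth 0 [:: a; b]); rewrite !big_ord_recl big_ord0 /= addn0.
Qed.

Lemma semigroup_span3 d1 d2 d3 x :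
  semigroup_span [:: d1; d2; d3] x <-> span3 d1 d2 d3 x.
Proof.
split=> [[a ->]|[a [b [c ->]]]].
  by exists (a 0), (a 1), (a 2); rewrite !big_ord_recl big_ord0 /= addn0 addnA.
by exists (nth 0 [:: a; b; c]); rewrite !big_ord_recl big_ord0 /= addn0 addnA.
Qed.

Lemma gapsE d1 d2 d3 x : gaps [:: d1; d2; d3] x <-> ~ span3 d1 d2 d3 x.
Proof.
split=> [[_ N] /semigroup_span3//|N]; split.
  by rewrite lt0n; apply/eqP => x0; apply: N; exists 0, 0, 0; lia.
by move=> /semigroup_span3.
Qed.

Lemma three_genus_lt_two_conductor d1 d2 d3 :
  gcdn (gcdn d1 d2) d3 = 1 -> 4 <= d1 -> d1 < d2 -> d2 < d3 ->
  ~ semigroup_span [:: d1; d3] d2 -> ~ semigroup_span [:: d1; d2] d3 ->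
  ~ symmetric_semigroup [:: d1; d2; d3] ->
  3 * genus [:: d1; d2; d3] < 2 * conductor [:: d1; d2; d3].
Proof.
move=> hgcd d1_ge4 lt12 lt23 hmin2 hmin3 hnsym.
have min2 : ~ (exists x y, d2 = x * d1 + y * d3) by move=> /semigroup_span2.
have min3 : ~ (exists x y, d3 = x * d1 + y * d2) by move=> /semigroup_span2.
have pos1 : 0 < d1 by lia.
have pos2 : 0 < d2 by lia.
have pos3 : 0 < d3 by lia.
set d := [:: d1; d2; d3] in hnsym *.
have [N cofin] := span3_cofinite pos2 pos3 hgcd.
have ubN x : gaps d x -> x <= N.
  by move=> /gapsE Nx; rewrite leqNgt; apply/negP => /ltnW /cofin.
have gap1 : gaps d 1 by apply/gapsE => -[[|a] [[|b] [[|c]]]]; nia.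
rewrite /conductor; move: hnsym; rewrite /symmetric_semigroup.
have NF : ~ span3 d1 d2 d3 (frobenius d).
  by apply/gapsE; apply: frobenius_gap ubN gap1.
have maxF x : ~ span3 d1 d2 d3 x -> x <= frobenius d.
  by move=> /gapsE; apply: leq_frobenius ubN.
move: (frobenius d) NF maxF => F NF maxF {}hnsym.
have PF : pseudo_frobenius d1 d2 d3 F.
  by split=> //; apply: contrapT => /maxF; lia.
have below := gap_below_pseudo_frobenius pos1 pos2 pos3 maxF.
(* A gap s with F - s also a gap lies below a pseudo-Frobenius number f with
   f - s in the semigroup, hence f <> F. *)
have [f [Pf nfF]] : exists f, pseudo_frobenius d1 d2 d3 f /\ f <> F.
  apply: contrapT => onlyF; apply: hnsym => s /gapsE Ns /gapsE NFs.
  have [f [Pf _ Sf]] := below s Ns.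
  by apply: onlyF; exists f; split=> // Ef; apply: NFs; rewrite -Ef.
have ltfF : f < F by have [Nf _ _ _] := Pf; have := maxF f Nf; lia.
have Egenus : genus d = \sum_(x < F.+1) ~~ `[< span3 d1 d2 d3 x >].
  rewrite (@genus_sum d F) => [|x /gapsE/maxF//].
  by apply: eq_bigr => x _; congr nat_of_bool; rewrite -asbool_neg;
     apply: asbool_equiv_eq; apply: gapsE.
rewrite Egenus; pose s x := `[< span3 d1 d2 d3 x >].
apply: (two_reflections_bound (s := s) ltfF) => [x lexF /asboolPn Nx|].
  have [g [Pg leg Sg]] := below x Nx.
  have [EFf|Efg|Efg] := pseudo_frobenius_at_most_two pos2 PF Pf Pg.
  - by case: nfF.
  - by apply/orP; right; rewrite Efg leg /=; apply/asboolP.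
  - by apply/orP; left; rewrite Efg; apply/asboolP.
case: (strictness_witness hgcd d1_ge4 lt12 lt23 min2 min3 PF Pf ltfF).
  by move=> [y ley Sy]; left; exists y => //; apply/asboolP.
move=> [x lex [S1 S2]]; right; exists x => //.
by apply/andP; split; apply/asboolP.
Qed.

Theorem theorem1 (d1 d2 d3 : nat)
    (hgcd : gcdn (gcdn d1 d2) d3 = 1)
    (h4 : 4 <= d1) (h12 : d1 < d2) (h23 : d2 < d3)
    (h3 : d3 <= d1 * d2 - d1 - d2)
    (hmin1 : ~ semigroup_span [:: d2; d3] d1)
    (hmin2 : ~ semigroup_span [:: d1; d3] d2)
    (hmin3 : ~ semigroup_span [:: d1; d2] d3)
    (hnsym : ~ symmetric_semigroup [:: d1; d2; d3]) :
  [/\ (wilf_ratio [:: d1; d2; d3] <= 2%:R / 3%:R)%R,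
      wilf_ratio [:: d1; d2; d3] = (2%:R / 3%:R)%R ->
        (d1, d2, d3) = (3, 4, 5)
    & (wilf_ratio [:: d1; d2; d3] < 2%:R / 3%:R)%R].
Proof.
have lt_wilf : (wilf_ratio [:: d1; d2; d3] < 2%:R / 3%:R)%R.
  rewrite /wilf_ratio ltr_pdivrMr ?ltr0n // mulrAC ltr_pdivlMr ?ltr0n //.
  rewrite -!natrM ltr_nat mulnC.
  exact: three_genus_lt_two_conductor.
split=> //; first exact: ltW.
by move=> E; rewrite E ltxx in lt_wilf.
Qed.
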